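(* For every integer $k\ge 0$, every integer $m\ge 2$ and every integer $i$ with $1\le i\le m-1$, $$\tilde d_{i,k}^2(m)\bigl(\tilde d_{i,k}^2(m)-\tilde d_{i-1,k}(m)\tilde d_{i+1,k}(m)\bigr)>\tilde d_{i-1,k}^2(m)\bigl(\tilde d_{i+1,k}^2(m)-\tilde d_{i,k}(m)\tilde d_{i+2,k}(m)\bigr).$$
   Context: For integers $m\ge 0$ and $0\le i\le m$, the Boros–Moll numbers are $$d_i(m)=2^{-2m}\sum_{j=i}^{m}2^j\binom{2m-2j}{m-j}\binom{m+j}{j}\binom{j}{i},$$ with the convention $d_i(m)=0$ for $i>m$. For an integer $k\ge 0$ the normalized Boros–Moll numbers are $\tilde d_{i,k}(m)=d_i(m)/(i+k)!$ for $i\ge 0$ (so $\tilde d_{i,k}(m)=0$ for $i>m$). *)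

(* Defs.v *)
From mathcomp Require Import all_boot all_order all_algebra.
Set Implicit Arguments. Unset Strict Implicit. Unset Printing Implicit Defensive.
Import Order.TTheory GRing.Theory Num.Theory.
Local Open Scope ring_scope.

Definition bm_d (i m : nat) : rat :=
  if (i <= m)%N then
    (2%:R ^+ (2 * m))^-1 *
    \sum_(i <= j < m.+1)
       (2 ^ j * 'C(2 * m - 2 * j, m - j) * 'C(m + j, j) * 'C(j, i))%:R
  else 0.

Definition bm_dt (k i m : nat) : rat := bm_d i m / ((i + k)`!)%:R.

(* Main.v *)
Require Import Defs.
From mathcomp Require Import all_boot all_order all_algebra.
From mathcomp Require Import ring lra.
Import Order.TTheory GRing.Theory Num.Theory.
Local Open Scope ring_scope.

(** Clearing factorials, the inequality for general [k] follows from
    log-concavity and the inequality for the [d_i] themselves (the limit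
    [k -> oo]).  The [d_i] satisfy the three-term recurrence
    [(i+1)(i+2) d_(i+2) = (i+1)(2m+1) d_(i+1) - (m-i)(m+i+1) d_i], so all four
    consecutive terms are determined by [d_i] and the defect
    [e = (m-i) - (i+1) d_(i+1) / d_i].  Downward induction on [i] along the
    recurrence gives [0 < e] and [(2i+3) e <= m-i].  Writing
    [m-i = (2i+3) e + t], the inequality becomes the positivity of a polynomial
    in [i], [e], [t], all of whose coefficients turn out to be nonnegative. *)

(** * Coefficients in powers of [x + 1] *)

(** Up to the factor [2^(-2m)], the coefficient of [(x + 1)^j] in the Boros-Moll polynomial, whose
    coefficient of [x^i] is [d_i(m)]. *)
Definition bm_coef (m j : nat) : rat :=
  (2 ^ j * 'C(2 * m - 2 * j, m - j) * 'C(m + j, j))%:R.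

Lemma bm_coef_gt0 (m j : nat) : (j <= m)%N -> 0 < bm_coef m j.
Proof.
move=> jm; rewrite /bm_coef ltr0n !muln_gt0 expn_gt0 !bin_gt0 leq_addl andbT /=.
by rewrite -mulnBr leq_pmull.
Qed.

Lemma mulSn_central_bin (p : nat) :
  (p.+1 * 'C(2 * p.+1, p.+1) = 2 * (2 * p).+1 * 'C(2 * p, p))%N.
Proof.
have e1 := mul_bin_diag (2 * p).+2 p; have e2 := mul_bin_down (2 * p).+1 p.
have e3 : (2 * p.+1 = (2 * p).+2)%N by rewrite mulnS.
rewrite e3 -e1; rewrite /= in e2.
have e4 : ((2 * p).+1 - p = p.+1)%N by rewrite mul2n -addnn -addSn addnK.
rewrite e4 in e2.
by rewrite /= -e3 -!mulnA e2.
Qed.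

Lemma bm_coefS (m j : nat) : (j < m)%N ->
  j.+1%:R * (2 * m%:R - 1 - 2 * j%:R) * bm_coef m j.+1 =
  (m%:R - j%:R) * (m%:R + j%:R + 1) * bm_coef m j.
Proof.
move=> jm; rewrite /bm_coef -!mulnBr.
have [p mE] : exists p, m = (j + p.+1)%N.
  by exists (m - j).-1; rewrite prednK ?subn_gt0 // subnKC // ltnW.
have -> : (m - j.+1 = p)%N by rewrite mE addnS -addSn addKn.
have -> : (m - j = p.+1)%N by rewrite mE addKn.
have /(congr1 (fun n => n%:R : rat)) := mulSn_central_bin p.
have /(congr1 (fun n => n%:R : rat)) := mul_bin_diag (m + j).+1 j.
rewrite /= addnS expnS !natrM => e1 e2.
have mR : m%:R = j%:R + p%:R + 1 :> rat by rewrite mE natrD -natr1 addrA.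
rewrite -[(2 * p).+1%:R]natr1 -[p.+1%:R]natr1 natrM in e2.
rewrite -[(m + j).+1%:R]natr1 natrD in e1.
have -> : 2 * m%:R - 1 - 2 * j%:R = 2 * p%:R + 1 :> rat by rewrite mR; ring.
have -> : m%:R - j%:R = p%:R + 1 :> rat by rewrite mR; ring.
transitivity ((2 ^ j)%:R * (2 * (2 * p%:R + 1) * 'C(2 * p, p)%:R) *
  (j.+1%:R * 'C((m + j).+1, j.+1)%:R) : rat); first by ring.
by rewrite -e1 -e2; ring.
Qed.

(** * The three-term recurrence in the lower index *)

Lemma mulSr_bin (j l : nat) :
  l.+1%:R * 'C(j, l.+1)%:R = (j%:R - l%:R) * 'C(j, l)%:R :> rat.
Proof.
have [lj|jl] := leqP l j.
  by rewrite -natrB // -!natrM mul_bin_left.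
by rewrite !bin_small ?mulr0 // ltnW.
Qed.

Lemma mulSr_binS (j l : nat) :
  j.+1%:R * 'C(j, l)%:R = (j.+1%:R - l%:R) * 'C(j.+1, l)%:R :> rat.
Proof.
have [lj|jl] := leqP l j.+1.
  by rewrite -natrB // -!natrM -(mul_bin_down j.+1 l).
by rewrite !bin_small ?mulr0 // ltnW.
Qed.

(** Terms with [j < i] vanish, so the range of summation can be made independent of [i]; linear
    combinations of several [d_i] can then be formed term by term. *)
Lemma bm_dE (i m : nat) :
  bm_d i m = (2%:R ^+ (2 * m))^-1 * \sum_(j < m.+1) bm_coef m j * 'C(j, i)%:R.
Proof.
rewrite /bm_d; case: leqP => [im|mi]; last first.
  rewrite big1 ?mulr0 // => j _; rewrite bin_small ?mulr0 //.
  exact: leq_trans (ltn_ord j) mi.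
congr (_ * _).
rewrite -(big_mkord xpredT (fun j => bm_coef m j * 'C(j, i)%:R)).
rewrite [RHS](big_cat_nat (n := i)) //= ?(leq_trans im) //.
rewrite [X in _ = X + _](_ : _ = 0); last first.
  by rewrite big_nat big1 // => j /andP[_ ji]; rewrite bin_small ?mulr0.
by rewrite add0r; apply: eq_bigr => j _; rewrite natrM.
Qed.

Lemma bm_d_gt0 (i m : nat) : (i <= m)%N -> 0 < bm_d i m.
Proof.
move=> im; rewrite bm_dE mulr_gt0 ?invr_gt0 ?exprn_gt0 //.
rewrite (bigD1 (Ordinal (im : (i < m.+1)%N))) //= ltr_pwDl //.
  by rewrite mulr_gt0 ?bm_coef_gt0 // ltr0n bin_gt0.
by apply: sumr_ge0 => j _; rewrite mulr_ge0 // ltW // bm_coef_gt0 // -ltnS.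
Qed.

Lemma bm_d_small (i m : nat) : (m < i)%N -> bm_d i m = 0.
Proof. by rewrite /bm_d ltnNge => /negPf->. Qed.

(** The recurrence telescopes in [j]: by [bm_coefS] and absorption, the summand is the difference of
    the right-hand side at [j] and at [j - 1]. *)
Lemma bm_partial_sum (m l n : nat) : (n <= m)%N ->
  \sum_(j < n.+1) bm_coef m j *
    ((m%:R - l%:R) * (m%:R + l%:R + 1) * 'C(j, l)%:R
     - l.+1%:R * (2 * m%:R + 1) * 'C(j, l.+1)%:R
     + l.+1%:R * l.+2%:R * 'C(j, l.+2)%:R) =
  (m%:R - n%:R) * (m%:R + n%:R + 1) * bm_coef m n * 'C(n, l)%:R.
Proof.
(* Absorption turns all three binomials into multiples of ['C(j, l)]. *)
have termE j : (m%:R - l%:R) * (m%:R + l%:R + 1) * 'C(j, l)%:R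
     - l.+1%:R * (2 * m%:R + 1) * 'C(j, l.+1)%:R
     + l.+1%:R * l.+2%:R * 'C(j, l.+2)%:R =
  ((m%:R - j%:R) * (m%:R + j%:R + 1)
   - (j%:R - l%:R) * (2 * m%:R + 1 - 2 * j%:R)) * 'C(j, l)%:R :> rat.
  rewrite -[_ * l.+2%:R * _]mulrA mulSr_bin -[_ * _ * 'C(j, l.+1)%:R]mulrAC.
  rewrite mulSr_bin mulrCA mulSr_bin -[l.+1%:R]natr1; ring.
under eq_bigr => j _ do rewrite termE.
elim: n => [|n IHn] nm.
  rewrite big_ord_recl big_ord0 addr0 /=.
  case: l {termE} => [|l]; last by rewrite bin0n !mulr0.
  by rewrite bin0; ring.
rewrite big_ord_recr /= IHn ?(ltnW nm) // -bm_coefS // (mulrC (_ * _) (bm_coef _ _)).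
rewrite -!(mulrA (bm_coef _ _)) [_ * _ * 'C(n, l)%:R]mulrAC mulSr_binS -[n.+1%:R]natr1.
ring.
Qed.

(** At [n = m] the telescoped sum has the factor [m - n = 0]. Since [l] is arbitrary, boundary cases
    with [d_(m+1)(m) = 0] are included. *)
Lemma bm_d_rec (m l : nat) :
  (m%:R - l%:R) * (m%:R + l%:R + 1) * bm_d l m
  - l.+1%:R * (2 * m%:R + 1) * bm_d l.+1 m
  + l.+1%:R * l.+2%:R * bm_d l.+2 m = 0.
Proof.
have := bm_partial_sum m l m (leqnn m).
rewrite subrr !mul0r.
under eq_bigr => j _ do rewrite mulrDr mulrBr 3!(mulrCA (bm_coef _ _)).
rewrite big_split sumrB /= -!mulr_sumr => H.
by rewrite !bm_dE 3!(mulrCA _ _^-1) -mulrBr -mulrDr H mulr0.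
Qed.

(** * Two-sided bounds on consecutive ratios *)

Lemma bm_d_ratio_bounds (m l : nat) : (l < m)%N ->
  l.+1%:R * bm_d l.+1 m < (m%:R - l%:R) * bm_d l m /\
  2 * (m%:R - l%:R) * bm_d l m <= (2 * l%:R + 3) * bm_d l.+1 m.
Proof.
move=> lm.
have [n mE] : exists n, m = (l + n.+1)%N.
  by exists (m - l).-1; rewrite prednK ?subn_gt0 // subnKC // ltnW.
elim: n l lm mE => [|n IHn] l lm mE.
  (* Here [m = l + 1], so [D2 = 0] and the recurrence fixes the ratio: the lower bound is an
     equality. *)
  have := bm_d_rec m l; rewrite (bm_d_small l.+2) ?mE ?addn1 // mulr0 addr0.
  have := bm_d_gt0 l.+1 l.+1 (leqnn _).
  rewrite -[l.+1%:R]natr1; have := ler0n rat l.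
  move: (bm_d _ _) (bm_d _ _) (l%:R) => D0 D1 x x0 D1_gt0 rec.
  have rec' : (x + 1) * (2 * D0 - (2 * x + 3) * D1) = 0 by rewrite -rec; ring.
  have D0E : 2 * D0 = (2 * x + 3) * D1.
    apply/eqP; rewrite -subr_eq0; have /eqP := rec'.
    by rewrite mulf_eq0 => /orP[/eqP|//]; lra.
  by split; nra.
have l1m : (l.+1 < m)%N by rewrite mE !addnS !ltnS leq_addr.
have [|upper lower] := IHn l.+1 l1m; first by rewrite mE addSnnS.
have := bm_d_rec m l; have := bm_d_gt0 l.+1 m (ltnW l1m).
have l0 := ler0n rat l; have n0 := ler0n rat n.
have vE : m%:R - l%:R = n%:R + 2 :> rat by rewrite mE natrD -!natr1; ring.
have -> : m%:R + l%:R + 1 = n%:R + 2 + 2 * l%:R + 1 :> rat by lra.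
have -> : 2 * m%:R + 1 = 2 * (n%:R + 2 + l%:R) + 1 :> rat by lra.
move: upper lower; have -> : m%:R - l.+1%:R = n%:R + 1 :> rat.
  by rewrite -natr1; lra.
rewrite vE -[l.+2%:R]natr1 -[l.+1%:R]natr1.
move: (bm_d l m) (bm_d l.+1 m) (bm_d l.+2 m) (l%:R : rat) (n%:R : rat) l0 n0.
move=> D0 D1 D2 x y x0 y0 {l n lm mE IHn l1m vE} upper lower D1_gt0 rec.
have v_gt0 : 0 < y + 2 * x + 3 by lra.
split.
  (* Multiplying by [m + l + 1] lets the recurrence eliminate [D0], leaving [l + 1] times the gap at
     [l + 1] plus [D1]. *)
  rewrite -subr_gt0 -(pmulr_rgt0 _ v_gt0).
  have -> : (y + 2 * x + 3) * ((y + 2) * D0 - (x + 1) * D1) =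
    (x + 1) * ((y + 1) * D1 - (x + 1 + 1) * D2 + D1).
    by apply/eqP; rewrite -subr_eq0 -[X in _ == X]rec; apply/eqP; ring.
  by rewrite mulr_gt0 //; lra.
have w_gt0 : 0 < (y + 2 * x + 3) * (2 * x + 5) by rewrite mulr_gt0 //; lra.
rewrite -subr_ge0 -(pmulr_rge0 _ w_gt0).
(* The factor [2 * x + 5] is the coefficient of [D2] in the lower bound at [l + 1]; it makes that
   gap appear with a positive multiple of [D1] left over. *)
have -> : (y + 2 * x + 3) * (2 * x + 5) *
    ((2 * x + 3) * D1 - 2 * (y + 2) * D0) =
  3 * (y + 1) * D1 +
  2 * (x + 1) * (x + 2) * ((2 * (x + 1) + 3) * D2 - 2 * (y + 1) * D1).
  apply/eqP; rewrite -subr_eq0 -(mulr0 (- 2 * (2 * x + 5))).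
  by rewrite -[X in _ == _ * X]rec; apply/eqP; ring.
apply: addr_ge0; first by apply: mulr_ge0; lra.
by rewrite mulr_ge0 ?subr_ge0 // !mulr_ge0 //; lra.
Qed.

(* Up to a positive factor, [Y^2(Y^2 - XZ) - X^2(Z^2 - YW)] for consecutive
   [X, Y, Z, W = d_(i-1), ..., d_(i+2)] with [n = m-i] and [(i+1) Z = (n-e) Y]. *)
Definition briggs_numerator (i n e : rat) : rat :=
  let A := (n + 1) * (n + 2 * i) in
  let A' := n * (n + 2 * i + 1) in
  let g := e * (2 * i + 1 + e) in
  let r := n + 2 * i + 1 + e in
  (i + 1) * (i + 2) * A * ((i + 1) * A - i * (A' - g))
  - i ^+ 2 * (A' - g) ^+ 2 - i ^+ 2 * (i + 1) * g * r ^+ 2.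

(* Dispatches on the syntax of the goal: applying [addr_ge0] blindly would unfold
   the numerals into iterated sums. *)
Ltac nonneg_terms :=
  repeat lazymatch goal with
  | |- is_true (0 <= _ + _) => apply: addr_ge0
  | |- is_true (0 <= _ * _) => apply: mulr_ge0
  | |- is_true (0 <= _ ^+ _) => apply: exprn_ge0
  | |- is_true (0 <= 1) => exact: ler01
  | |- is_true (0 <= _ *+ _) => exact: ler0n
  | |- _ => assumption
  end.

Lemma briggs_numerator_gt0 (i e t : rat) : 0 < i -> 0 <= e -> 0 <= t ->
  0 < briggs_numerator i ((2 * i + 3) * e + t) e.
Proof.
move=> i_gt0 e0 t0; have i0 := ltW i_gt0.
have -> : briggs_numerator i ((2 * i + 3) * e + t) e = 8 * i ^+ 2 +
  ((2 * t ^+ 2 + 4 * t ^+ 3 + 2 * t ^+ 4 + 12 * e * t + 36 * e * t ^+ 2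
    + 24 * e * t ^+ 3 + 18 * e ^+ 2 + 108 * e ^+ 2 * t + 108 * e ^+ 2 * t ^+ 2
    + 108 * e ^+ 3 + 216 * e ^+ 3 * t + 162 * e ^+ 4)
  + i * (8 * t + 19 * t ^+ 2 + 14 * t ^+ 3 + 3 * t ^+ 4 + 24 * e + 124 * e * t
    + 152 * e * t ^+ 2 + 52 * e * t ^+ 3 + 201 * e ^+ 2 + 536 * e ^+ 2 * t
    + 308 * e ^+ 2 * t ^+ 2 + 618 * e ^+ 3 + 768 * e ^+ 3 * t + 693 * e ^+ 4)
  + i ^+ 2 * (32 * t + 36 * t ^+ 2 + 12 * t ^+ 3 + 115 * e + 303 * e * t
    + 200 * e * t ^+ 2 + 24 * e * t ^+ 3 + 597 * e ^+ 2 + 937 * e ^+ 2 * t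
    + 268 * e ^+ 2 * t ^+ 2 + 1334 * e ^+ 3 + 966 * e ^+ 3 * t + 1132 * e ^+ 4)
  + i ^+ 3 * (20 + 42 * t + 22 * t ^+ 2 + 197 * e + 295 * e * t
    + 80 * e * t ^+ 2 + 772 * e ^+ 2 + 679 * e ^+ 2 * t + 72 * e ^+ 2 * t ^+ 2
    + 1354 * e ^+ 3 + 510 * e ^+ 3 * t + 885 * e ^+ 4)
  + i ^+ 4 * (16 + 22 * t + 2 * t ^+ 2 + 146 * e + 108 * e * t + 462 * e ^+ 2
    + 170 * e ^+ 2 * t + 646 * e ^+ 3 + 96 * e ^+ 3 * t + 332 * e ^+ 4)
  + i ^+ 5 * (4 + 4 * t + 40 * e + 4 * e * t + 104 * e ^+ 2 + 116 * e ^+ 3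
    + 48 * e ^+ 4)).
  by rewrite /briggs_numerator; ring.
(* The isolated term [8 * i ^+ 2] supplies strictness. *)
apply: ltr_pwDl; first by rewrite mulr_gt0 ?exprn_gt0.
by nonneg_terms.
Qed.

(** * Log-concavity and the inequality for the [d_i] *)

Lemma rec_prevE (i n e X Y Z : rat) : 0 < i -> 0 < n ->
  (n + 1) * (n + 2 * i) * X - i * (2 * (n + i) + 1) * Y + i * (i + 1) * Z = 0 ->
  (i + 1) * Z = (n - e) * Y ->
  X = i * (n + 2 * i + 1 + e) * Y / ((n + 1) * (n + 2 * i)).
Proof.
move=> i_gt0 n_gt0 rec ZE.
have A0 : (n + 1) * (n + 2 * i) != 0 by rewrite mulf_neq0 // gt_eqF //; lra.
apply/(mulfI A0); rewrite [RHS]mulrC divfK //.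
apply/eqP; rewrite -subr_eq0 -[X in _ == X]rec -(mulrA i (i + 1)) ZE.
by apply/eqP; ring.
Qed.

Lemma rec_nextE (i n e Y Z W : rat) : 0 < i ->
  n * (n + 2 * i + 1) * Y - (i + 1) * (2 * (n + i) + 1) * Z
    + (i + 1) * (i + 2) * W = 0 ->
  (i + 1) * Z = (n - e) * Y ->
  W = ((2 * (n + i) + 1) * (n - e) - n * (n + 2 * i + 1)) * Y
    / ((i + 1) * (i + 2)).
Proof.
move=> i_gt0 rec ZE.
have A0 : (i + 1) * (i + 2) != 0 by rewrite mulf_neq0 // gt_eqF //; lra.
apply/(mulfI A0); rewrite [RHS]mulrC divfK //.
apply/eqP; rewrite -subr_eq0 -[X in _ == X]rec [_ * _ * Z]mulrAC ZE.
by apply/eqP; ring.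
Qed.

Lemma log_concave_of_rec (i n e X Y Z : rat) : 0 < i -> 0 < n -> 0 <= e ->
  (n + 1) * (n + 2 * i) * X - i * (2 * (n + i) + 1) * Y + i * (i + 1) * Z = 0 ->
  (i + 1) * Z = (n - e) * Y ->
  X * Z <= Y ^+ 2.
Proof.
move=> i_gt0 n_gt0 e0 rec ZE; rewrite -subr_ge0 (rec_prevE _ _ _ _ _ _ i_gt0 n_gt0 rec ZE).
have i1_neq0 : i + 1 != 0 by rewrite gt_eqF //; lra.
have -> : Z = (n - e) * Y / (i + 1) by rewrite -ZE mulrC mulKf.
rewrite [X in 0 <= X](_ : _ = Y ^+ 2 * ((n + 1) * (n + 2 * i)
    + i * (2 * i + e * (2 * i + 1 + e))) / ((i + 1) * (n + 1) * (n + 2 * i))).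
  have [n0 i0] := (ltW n_gt0, ltW i_gt0).
  by rewrite -mulrA mulr_ge0 ?sqr_ge0 // divr_ge0 //; nonneg_terms.
by field; rewrite i1_neq0 !gt_eqF //; lra.
Qed.

Lemma briggs_of_rec (i n e X Y Z W : rat) :
  0 < i -> 0 < n -> 0 < Y -> 0 <= e -> (2 * i + 3) * e <= n ->
  (n + 1) * (n + 2 * i) * X - i * (2 * (n + i) + 1) * Y + i * (i + 1) * Z = 0 ->
  n * (n + 2 * i + 1) * Y - (i + 1) * (2 * (n + i) + 1) * Z
    + (i + 1) * (i + 2) * W = 0 ->
  (i + 1) * Z = (n - e) * Y ->
  X ^+ 2 * (Z ^+ 2 - Y * W) < Y ^+ 2 * (Y ^+ 2 - X * Z).
Proof.
move=> i_gt0 n_gt0 Y_gt0 e0 e_le recX recW ZE; rewrite -subr_gt0.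
rewrite (rec_prevE _ _ _ _ _ _ i_gt0 n_gt0 recX ZE) (rec_nextE _ _ _ _ _ _ i_gt0 recW ZE).
have i1_neq0 : i + 1 != 0 by rewrite gt_eqF //; lra.
have -> : Z = (n - e) * Y / (i + 1) by rewrite -ZE mulrC mulKf.
have F_gt0 : 0 < briggs_numerator i n e.
  (* Take [t = n - (2 * i + 3) * e], nonnegative by [e_le]. *)
  rewrite -[n](addrNK ((2 * i + 3) * e)) addrC.
  by rewrite briggs_numerator_gt0 ?subr_ge0.
rewrite [X in 0 < X](_ : _ = Y ^+ 4 * briggs_numerator i n e
  / ((n + 1) ^+ 2 * (n + 2 * i) ^+ 2 * (i + 1) ^+ 2 * (i + 2))).
  rewrite divr_gt0 ?mulr_gt0 ?exprn_gt0 //; lra.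
by rewrite /briggs_numerator; field; rewrite i1_neq0 !gt_eqF //; lra.
Qed.

(** * Passage to the normalized numbers *)

(** Applied with [c = i + k] and [f = (i + k - 1)!]. Over a common denominator, the difference is
    [c ^+ 2 * (c + 1)] times the undivided difference [S], plus terms made nonnegative by
    [X * Z <= Y ^+ 2]. *)
Lemma briggs_div_factorial (c f X Y Z W : rat) :
  0 < c -> 0 < f -> 0 <= X -> 0 <= Z -> X * Z <= Y ^+ 2 ->
  X ^+ 2 * (Z ^+ 2 - Y * W) < Y ^+ 2 * (Y ^+ 2 - X * Z) ->
  (X / f) ^+ 2 * ((Z / ((c + 1) * (c * f))) ^+ 2
    - Y / (c * f) * (W / ((c + 2) * ((c + 1) * (c * f))))) <
  (Y / (c * f)) ^+ 2 * ((Y / (c * f)) ^+ 2 - X / f * (Z / ((c + 1) * (c * f)))).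
Proof.
move=> c_gt0 f_gt0 X0 Z0 XZ; rewrite -subr_gt0 -[in X in _ -> X]subr_gt0 => H.
set S := (X in 0 < X) in H; set Q := Y ^+ 2 in XZ; set P := X * Z in XZ.
have [P0 Q0] : 0 <= P /\ 0 <= Q by split; [exact: mulr_ge0 | exact: sqr_ge0].
rewrite [X in 0 < X](_ : _ = (c ^+ 2 * (c + 1) * S
    + (2 * c * (c + 1) * Q * (Q - P) + c ^+ 2 * ((Q - P) * (Q + P))
       + (3 * c + 2) * Q ^+ 2))
  / (f ^+ 4 * c ^+ 4 * (c + 1) ^+ 2 * (c + 2))); last first.
  by rewrite /S /P /Q; field; rewrite !gt_eqF //; lra.
have [c0 QP] : 0 <= c /\ 0 <= Q - P by rewrite subr_ge0 (ltW c_gt0).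
rewrite divr_gt0 //; last by rewrite !mulr_gt0 ?exprn_gt0 //; lra.
apply: ltr_pwDl; first by rewrite !mulr_gt0 ?exprn_gt0 //; lra.
by move: (Q - P) QP => D D0; nonneg_terms.
Qed.

Theorem theorem1p2 (k m i : nat) :
  (2 <= m)%N -> (1 <= i)%N -> (i <= m - 1)%N ->
  bm_dt k (i - 1) m ^+ 2 *
    (bm_dt k (i + 1) m ^+ 2 - bm_dt k i m * bm_dt k (i + 2) m)
  < bm_dt k i m ^+ 2 *
    (bm_dt k i m ^+ 2 - bm_dt k (i - 1) m * bm_dt k (i + 1) m).
Proof.
case: i => // l _ _; case: m => // m; rewrite !subn1 /= => lm.
rewrite addn1 addn2 /bm_dt !addSn !factS !natrM.
have lm1 : (l.+1 < m.+1)%N by [].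
have [Z_lt Z_ge] := bm_d_ratio_bounds m.+1 l.+1 lm1.
have recX := bm_d_rec m.+1 l; have recW := bm_d_rec m.+1 l.+1.
have Y_gt0 := bm_d_gt0 l.+1 m.+1 (ltnW lm1).
have X_ge0 := ltW (bm_d_gt0 l m.+1 (ltnW (ltnW lm1))).
have Z_ge0 := ltW (bm_d_gt0 l.+2 m.+1 lm1).
have n_gt0 : 0 < m.+1%:R - l.+1%:R :> rat by rewrite subr_gt0 ltr_nat.
have i_gt0 : 0 < l.+1%:R :> rat by rewrite ltr0Sn.
have c_gt0 : 0 < (l + k).+1%:R :> rat by rewrite ltr0Sn.
have f_gt0 : 0 < ((l + k)`!)%:R :> rat by rewrite ltr0n fact_gt0.
have lE : l%:R = l.+1%:R - 1 :> rat by rewrite -natr1 addrK.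
rewrite lE -[l.+3%:R]natr1 -[l.+2%:R]natr1 in recX recW.
rewrite -[l.+2%:R]natr1 in Z_lt.
rewrite -[(l + k).+3%:R]natr1 -[(l + k).+2%:R]natr1 -addrA.
move: (bm_d l _) (bm_d l.+1 _) (bm_d l.+2 _) (bm_d l.+3 _) m.+1%:R l.+1%:R
  X_ge0 Y_gt0 Z_ge0 i_gt0 n_gt0 recX recW Z_lt Z_ge.
move=> X Y Z W M i X0 Y_gt0 Z0 i_gt0 n_gt0 recX recW Z_lt Z_ge.
(* Both recurrences are rewritten in terms of [n = M - i]. *)
have recX' : (M - i + 1) * (M - i + 2 * i) * X - i * (2 * (M - i + i) + 1) * Y
  + i * (i + 1) * Z = 0 by rewrite -recX; ring.
have recW' : (M - i) * (M - i + 2 * i + 1) * Y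
  - (i + 1) * (2 * (M - i + i) + 1) * Z + (i + 1) * (i + 2) * W = 0.
  by rewrite -recW; ring.
pose e := M - i - (i + 1) * Z / Y.
have e_ge0 : 0 <= e by rewrite subr_ge0 ler_pdivrMr // ltW.
have ZE : (i + 1) * Z = (M - i - e) * Y.
  by rewrite /e subKr divfK // gt_eqF.
have e_le : (2 * i + 3) * e <= M - i.
  (* This is [Z_ge] multiplied by [(i + 1) / Y]. *)
  rewrite -subr_ge0 (_ : _ - _ = (i + 1) * ((2 * i + 3) * Z
    - 2 * (M - i) * Y) / Y); last by rewrite /e; field; rewrite gt_eqF.
  rewrite divr_ge0 ?(ltW Y_gt0) // mulr_ge0 ?subr_ge0 // addr_ge0 //.
  exact: ltW.
apply: briggs_div_factorial => //.
  exact: (log_concave_of_rec i (M - i) e).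
exact: (briggs_of_rec i (M - i) e).
Qed.
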